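(* Let $D_1, D_2 \subset \mathbb{R}^n$ be bounded domains, let $f : D_1 \to D_2$ be a diffeomorphism, and put $g(x) = f(x) - x$ for $x \in D_1$. (a) If $g$ is realized by a 2-mirror system whose first and second mirrors are $\mathrm{graph}(\Phi_1)$ and $\mathrm{graph}(\Phi_2)$, with smooth functions $\Phi_1 : D_1 \to \mathbb{R}$ and $\Phi_2 : D_2 \to \mathbb{R}$, then $g = \nabla G$ for a smooth function $G : D_1 \to \mathbb{R}$. Moreover, one has $G(x) = c\,\Phi_1(x)$ for $x \in D_1$, where $c$ is a positive constant. (b) If $D_1$ and $D_2$ are convex and disjoint and $g = \nabla G$ for a smooth function $G : D_1 \to \mathbb{R}$, then $g$ can be realized by infinitely many 2-mirror systems. These form a two-parameter family: there is $c_0 > 0$ such that for every $c > c_0$ and every $h \in \mathbb{R}$ there is a 2-mirror system realizing $g$ whose first mirror is the graph of the function $\Phi_1(x) = \frac{1}{c}\, G(x) + h$, $x \in D_1$ (the parameter $h$ determines the height of the system along the $z$-axis).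
   Context: Orthonormal coordinates in $\mathbb{R}^{n+1}$ are $(x,z)$ with $x = (x_1,\ldots,x_n) \in \mathbb{R}^n$, $z \in \mathbb{R}$. Mirrors are (pieces of) smooth hypersurfaces in $\mathbb{R}^{n+1}$. A light ray (billiard particle) moves with unit speed along straight lines in the complement of the mirrors, and when it hits a mirror at a point with normal vector $\nu$, its velocity $v$ is replaced by $v - 2\langle v, \nu\rangle \nu/|\nu|^2$. For a diffeomorphism $f : D_1 \to D_2$, $f(x) = x + g(x)$, one says that $f$ (equivalently, $g$) is realized by a 2-mirror system if there are two mirrors, $\mathrm{graph}(\Phi_1) = \{(x,\Phi_1(x)) : x \in D_1\}$ (first mirror) and $\mathrm{graph}(\Phi_2) = \{(y,\Phi_2(y)) : y \in D_2\}$ (second mirror), with $\Phi_1, \Phi_2$ smooth, such that for every $x \in D_1$ the following holds: the particle whose position at all sufficiently small (very negative) times $t$ is $(x,t)$ (so it moves in the direction of the $z$-axis) makes exactly two reflections, first at the point $(x, \Phi_1(x))$ of the first mirror and then at the point $(f(x), \Phi_2(f(x)))$ of the second mirror, has no other points in common with the mirrors, and after the second reflection moves again in the direction of the $z$-axis, having position $(f(x), t - \tau(x))$ for all sufficiently large $t$, for some number $\tau(x)$. *)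

(* Defs.v *)
From HB Require Import structures.
From mathcomp Require Import all_boot all_order all_algebra.
From mathcomp Require Import all_classical all_reals all_analysis.

Set Implicit Arguments.
Unset Strict Implicit.
Unset Printing Implicit Defensive.

Import Order.TTheory GRing.Theory Num.Theory.
Import numFieldNormedType.Exports.

Local Open Scope classical_set_scope.
Local Open Scope ring_scope.

(* Functions on a subset D of R^n are represented by total functions, of which
   only the values on D are used. As D is always open here, the derivatives at
   the points of D do not depend on the values outside D. *)

Definition bounded_domain (R : realType) (n : nat) (D : set 'rV[R]_n) : Prop :=
  [/\ open D, connected D, D !=set0 & bounded_set D].

Fixpoint Ck_on (R : realType) (n : nat) (W : normedModType R) (k : nat)
    (D : set 'rV[R]_n) (f : 'rV[R]_n -> W) : Prop :=
  (forall x, D x -> {for x, continuous f}) /\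
  (if k is k'.+1 then
     forall i : 'I_n, (forall x, D x -> derivable f x (delta_mx 0 i)) /\
       Ck_on k' D ('D_(delta_mx 0 i) f)
   else True).

(* C^oo on D: all iterated partial derivatives exist and are continuous. *)
Definition smooth_on (R : realType) (n : nat) (W : normedModType R)
    (D : set 'rV[R]_n) (f : 'rV[R]_n -> W) : Prop :=
  forall k, Ck_on k D f.

Definition diffeomorphism (R : realType) (n : nat) (D1 D2 : set 'rV[R]_n)
    (f : 'rV[R]_n -> 'rV[R]_n) : Prop :=
  set_fun D1 D2 f /\ smooth_on D1 f /\
  exists f' : 'rV[R]_n -> 'rV[R]_n,
    [/\ set_fun D2 D1 f', smooth_on D2 f',
        {in D1, cancel f f'} & {in D2, cancel f' f}].

Definition grad (R : realType) (n : nat) (F : 'rV[R]_n -> R)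
    (x : 'rV[R]_n) : 'rV[R]_n :=
  \row_(i < n) 'D_(delta_mx 0 i) F x.

(* MathComp-Analysis norms 'rV[R]_n by the maximum of the coordinates, so the
   Euclidean structure is given by this inner product. *)
Definition dot (R : realType) (n : nat) (u v : 'rV[R]_n) : R :=
  \sum_(i < n) u 0 i * v 0 i.

Definition reflect_along (R : realType) (n : nat) (nu v : 'rV[R]_n) :
    'rV[R]_n :=
  v - (2 * dot v nu / dot nu nu) *: nu.

(* The point (or vector) (x, z) of R^(n+1). *)
Definition pt (R : realType) (n : nat) (x : 'rV[R]_n) (z : R) : 'rV[R]_(n + 1) :=
  row_mx x z%:M.

Definition graph (R : realType) (n : nat) (D : set 'rV[R]_n)
    (Phi : 'rV[R]_n -> R) : set 'rV[R]_(n + 1) :=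
  [set pt x (Phi x) | x in D].

(* A normal vector at (x, Phi x): the gradient of (x, z) |-> Phi x - z. *)
Definition graph_normal (R : realType) (n : nat) (Phi : 'rV[R]_n -> R)
    (x : 'rV[R]_n) : 'rV[R]_(n + 1) :=
  pt (grad Phi x) (-1).

Definition uniform_motion (R : realType) (m : nat) (I : set R) (v : 'rV[R]_m)
    (gamma : R -> 'rV[R]_m) : Prop :=
  forall s t, I s -> I t -> gamma t = gamma s + (t - s) *: v.

(* gamma t is the position at time t of a unit speed particle which meets the
   union M of the mirrors at exactly two times t1 < t2, reflecting at p1 from a
   mirror with normal nu1 and then at p2 from a mirror with normal nu2. *)
Definition two_reflections (R : realType) (m : nat) (M : set 'rV[R]_m)
    (p1 nu1 p2 nu2 : 'rV[R]_m) (gamma : R -> 'rV[R]_m) : Prop :=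
  exists (t1 t2 : R) (v0 v1 v2 : 'rV[R]_m),
    [/\ t1 < t2, gamma t1 = p1, gamma t2 = p2 &
        forall t, M (gamma t) <-> t = t1 \/ t = t2] /\
    [/\ uniform_motion [set t | t <= t1] v0 gamma,
        uniform_motion [set t | t1 <= t <= t2] v1 gamma &
        uniform_motion [set t | t2 <= t] v2 gamma] /\
    [/\ dot v0 v0 = 1, v1 = reflect_along nu1 v0 & v2 = reflect_along nu2 v1].

Definition realized_by (R : realType) (n : nat) (D1 D2 : set 'rV[R]_n)
    (f : 'rV[R]_n -> 'rV[R]_n) (Phi1 Phi2 : 'rV[R]_n -> R) : Prop :=
  smooth_on D1 Phi1 /\ smooth_on D2 Phi2 /\
  forall x, D1 x -> exists gamma : R -> 'rV[R]_(n + 1),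
    [/\ \forall t \near -oo, gamma t = pt x t,
        two_reflections (graph D1 Phi1 `|` graph D2 Phi2)
          (pt x (Phi1 x)) (graph_normal Phi1 x)
          (pt (f x) (Phi2 (f x))) (graph_normal Phi2 (f x)) gamma &
        exists tau : R, \forall t \near +oo, gamma t = pt (f x) (t - tau)].

(* Main.v *)
Require Import Defs.
From HB Require Import structures.
From mathcomp Require Import all_boot all_order all_algebra.
From mathcomp Require Import all_classical all_reals all_analysis.
From mathcomp Require Import ring lra.
Import Order.TTheory GRing.Theory Num.Theory.
Import numFieldNormedType.Exports.
Local Open Scope classical_set_scope.
Local Open Scope ring_scope.

(* Let p = grad Phi1 x. Reflecting the vertical direction in the first mirror and
   requiring the second reflection to restore it forces grad Phi2 (f x) = p and
   f x - x = tau p, where tau > 0 is the delay with respect to the vertical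
   motion. With H = Phi2 o f - Phi1, the length of the middle segment gives
   tau = sqrt (|f x - x|^2 + H^2) - H, and the equality of the two normals makes
   every partial derivative of tau vanish: tau is constant, so G = tau Phi1.

   Conversely, grad Phi1 = (f x - x) / c and delay c determine
   Phi2 (f x) = Phi1 x + (|f x - x|^2 - c^2) / (2 c), and differentiating shows
   that the normals agree. For large c the middle segment is so steep that, by the
   mean value theorem on the convex domains, it meets the mirrors at its endpoints
   only. *)

(** * Inner product and coordinates of points of R^(n+1) *)

Lemma dot_pt {R : realType} {n : nat} (x y : 'rV[R]_n) (a b : R) :
  dot (pt x a) (pt y b) = dot x y + a * b.
Proof.
rewrite /dot /pt big_split_ord /= big_ord1; congr (_ + _).
  by apply: eq_bigr => i _; rewrite !row_mxEl.
by rewrite !row_mxEr !mxE !mulr1n.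
Qed.

Lemma pt_inj {R : realType} {n : nat} (x y : 'rV[R]_n) (a b : R) :
  pt x a = pt y b -> x = y /\ a = b.
Proof.
by move=> /eq_row_mx[-> /matrixP/(_ 0 0)]; rewrite !mxE !mulr1n.
Qed.

Lemma ptD {R : realType} {n : nat} (x y : 'rV[R]_n) (a b : R) :
  pt x a + pt y b = pt (x + y) (a + b).
Proof. by rewrite /pt add_row_mx -raddfD. Qed.

Lemma ptZ {R : realType} {n : nat} (k : R) (x : 'rV[R]_n) (a : R) :
  k *: pt x a = pt (k *: x) (k * a).
Proof. by rewrite /pt scale_row_mx scale_scalar_mx. Qed.

Lemma dotC {R : realType} {n : nat} (u v : 'rV[R]_n) : dot u v = dot v u.
Proof. by apply: eq_bigr => i _; rewrite mulrC. Qed.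

Lemma dotDl {R : realType} {n : nat} (u v w : 'rV[R]_n) :
  dot (u + v) w = dot u w + dot v w.
Proof. by rewrite -big_split; apply: eq_bigr => i _; rewrite mxE mulrDl. Qed.

Lemma dotZl {R : realType} {n : nat} (k : R) (u v : 'rV[R]_n) :
  dot (k *: u) v = k * dot u v.
Proof. by rewrite /dot mulr_sumr; apply: eq_bigr => i _; rewrite mxE mulrA. Qed.

Lemma dotDr {R : realType} {n : nat} (u v w : 'rV[R]_n) :
  dot w (u + v) = dot w u + dot w v.
Proof. by rewrite dotC dotDl !(dotC w). Qed.

Lemma dotZr {R : realType} {n : nat} (k : R) (u v : 'rV[R]_n) :
  dot u (k *: v) = k * dot u v.
Proof. by rewrite dotC dotZl dotC. Qed.

Lemma dot_ge0 {R : realType} {n : nat} (u : 'rV[R]_n) : 0 <= dot u u.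
Proof. by apply: sumr_ge0 => i _; rewrite -expr2 sqr_ge0. Qed.

(** * Directional derivatives and the mean value theorem *)

Lemma is_derive_line {R : realType} {V W : normedModType R} (F : V -> W)
    (x v : V) (s : R) : derivable F (x + s *: v) v ->
  is_derive s 1 (fun t : R => F (x + t *: v)) ('D_v F (x + s *: v)).
Proof.
rewrite /derivable /derive => dF.
(* The difference quotients on both sides are the same function of [h]. *)
have E : (fun h : R => h^-1 *: (((fun t : R => F (x + t *: v)) \o shift s) (h *: 1)
      - F (x + s *: v)))
   = (fun h : R => h^-1 *: ((F \o shift (x + s *: v)) (h *: v) - F (x + s *: v))).
  apply/funext => h /=; congr (_ *: (F _ - _)).
  by rewrite -[h%:A]/(h * 1) mulr1 scalerDl addrCA.
by split; rewrite /derivable /derive E.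
Qed.

(** Both signs of [t] occur, since [t] will be a coordinate of a displacement. The one-variable
    theorem is applied between [Num.min 0 t] and [Num.max 0 t]; for negative [t] the increment is
    reversed afterwards. *)
Lemma MVT_line {R : realType} {V : normedModType R} (F : V -> R) (x v : V) (t : R) :
  let between s := (0 <= s <= t) || (t <= s <= 0) in
  (forall s : R, between s -> derivable F (x + s *: v) v) ->
  exists2 s : R, between s & F (x + t *: v) - F x = t * 'D_v F (x + s *: v).
Proof.
move=> between dF; pose a : R := Num.min 0 t; pose b : R := Num.max 0 t.
have sub (s : R) : s \in `[a, b] -> between s.
  rewrite in_itv/= /between /a /b /Num.min /Num.max.
  by case: ltP => t0 ->; rewrite ?orbT.
have ab : a <= b by rewrite ge_min le_max lexx.
have der (s : R) : s \in `]a, b[ ->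
    is_derive s 1 (fun t : R => F (x + t *: v)) ('D_v F (x + s *: v)).
  by move=> /subset_itv_oo_cc sab; apply: is_derive_line; apply: dF; exact: sub.
have [|s sab e] := MVT_segment ab der.
  apply: derivable_within_continuous => s sab.
  by have [] := is_derive_line F x v s (dF s (sub s sab)).
exists s; first exact: sub.
move: e; rewrite /a /b /Num.min /Num.max; case: ltP => t0; rewrite ?scale0r ?addr0; last first.
  by rewrite sub0r mulrN mulrC => e; rewrite -opprB e opprK.
by rewrite subr0 mulrC => ->.
Qed.

Lemma coord_le_norm {R : realType} {n : nat} (u : 'rV[R]_n) i : `|u 0 i| <= `|u|.
Proof.
rewrite [leRHS]/Num.Def.normr/= mx_normrE.
exact: (le_bigmax _ (fun ij => `|u ij.1 ij.2|) (0, i)).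
Qed.

Lemma norm_le_coord {R : realType} {n : nat} (u : 'rV[R]_n) (M : R) :
  0 <= M -> (forall i, `|u 0 i| <= M) -> `|u| <= M.
Proof.
move=> M0 uM; rewrite [leLHS]/Num.Def.normr/= mx_normrE.
by apply: bigmax_le => // -[a i] _; rewrite /= (ord1 a).
Qed.

(* Moving from 0 to [h] through these, one coordinate at a time, stays in every
   ball of the maximum norm centered at 0 that contains [h]. *)
Definition first_coords {R : realType} {n : nat} (h : 'rV[R]_n) (k : nat) : 'rV[R]_n :=
  \row_j (if (j < k)%N then h 0 j else 0).

Lemma first_coordsS {R : realType} {n : nat} (h : 'rV[R]_n) (i : 'I_n) :
  first_coords h i.+1 = first_coords h i + h 0 i *: delta_mx 0 i.
Proof.
apply/rowP => j; rewrite !mxE eqxx /= ltnS leq_eqVlt.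
case: eqVneq => [/ord_inj ->|ne]; first by rewrite eqxx ltnn add0r mulr1.
have -> : (j == i) = false by apply: contra_neqF ne => /eqP ->.
by rewrite mulr0 addr0.
Qed.

Lemma first_coords_full {R : realType} {n : nat} (h : 'rV[R]_n) :
  first_coords h n = h.
Proof. by apply/rowP => j; rewrite mxE ltn_ord. Qed.

Lemma first_coords0 {R : realType} {n : nat} (h : 'rV[R]_n) :
  first_coords h 0 = 0.
Proof. by apply/rowP => j; rewrite !mxE. Qed.

Lemma first_coords_step_le {R : realType} {n : nat} (h : 'rV[R]_n) (i : 'I_n) (s : R) :
  `|s| <= `|h 0 i| -> `|first_coords h i + s *: delta_mx 0 i| <= `|h|.
Proof.
move=> sh; apply: norm_le_coord => // j; rewrite !mxE eqxx /=.
case: (ltngtP j i) => [ji|ji|/ord_inj ->].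
- by rewrite (_ : (j == i) = false) ?mulr0 ?addr0 ?coord_le_norm// -val_eqE /= ltn_eqF.
- by rewrite (_ : (j == i) = false) ?mulr0 ?addr0 ?normr0// -val_eqE /= gtn_eqF.
- by rewrite eqxx mulr1 add0r (le_trans sh)// coord_le_norm.
Qed.

(** Telescoping along [first_coords h]: consecutive points differ in one coordinate, so the mean
    value theorem gives each difference, at a point kept in the ball by [first_coords_step_le]. Only
    partial derivatives enter, so the formula can serve to prove differentiability. *)
Lemma increment_sum_partials {R : realType} {n : nat} (F : 'rV[R]_n -> R) (x h : 'rV[R]_n) :
  (forall y, `|y - x| <= `|h| -> forall i, derivable F y (delta_mx 0 i)) ->
  exists2 xi : 'I_n -> 'rV[R]_n, (forall i, `|xi i - x| <= `|h|) &
    F (x + h) - F x = \sum_(i < n) h 0 i * 'D_(delta_mx 0 i) F (xi i).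
Proof.
move=> dF.
have shiftE (i : 'I_n) u : x + first_coords h i + u - x = first_coords h i + u.
  by rewrite -(addrA x) addrAC subrr add0r.
have absE (s t : R) : (0 <= s <= t) || (t <= s <= 0) -> `|s| <= `|t|.
  case/orP => /andP[s0 st]; first by rewrite !ger0_norm// (le_trans s0).
  by rewrite !ler0_norm ?lerN2// (le_trans s0).
have step (i : 'I_n) : exists y : 'rV[R]_n, `|y - x| <= `|h| /\
    F (x + first_coords h i.+1) - F (x + first_coords h i) =
    h 0 i * 'D_(delta_mx 0 i) F y.
  have [s sh|s sh e] := @MVT_line _ _ F (x + first_coords h i) (delta_mx 0 i) (h 0 i).
    by apply: dF; rewrite shiftE first_coords_step_le// absE.
  exists (x + first_coords h i + s *: delta_mx 0 i).
  by rewrite shiftE first_coords_step_le ?absE// first_coordsS addrA.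
have [xi xiP] := choice step.
exists xi => [i|]; first by have [] := xiP i.
under eq_bigr do rewrite -(xiP _).2.
rewrite -(big_mkord predT (fun i => F (x + first_coords h i.+1) - F (x + first_coords h i))).
by rewrite telescope_sumr// first_coords_full first_coords0 addr0.
Qed.

(** * Total differentiability and the chain rule *)

Lemma differentiable_littleo {K : numFieldType} {V W : normedModType K}
    (f : V -> W) (df : {linear V -> W}) (x : V) :
  continuous df -> f \o shift x = cst (f x) + df +o_ 0 id -> differentiable f x.
Proof. by move=> cdf fE; apply/diff_locallyP; rewrite (diff_unique cdf fE). Qed.

Lemma dot_continuous {R : realType} {n : nat} (a : 'rV[R]_n) : continuous (dot a).
Proof.
apply: continuous_big => [|i _ v]; first exact: add_continuous.
apply: (@continuousM R _ (cst (a 0 i)) (fun w : 'rV[R]_n => w 0 i) v).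
  exact: cst_continuous.
exact: coord_continuous.
Qed.

(** The error of the linear approximation [dot (grad F x) h] is a sum of terms [h 0 i] times the
    variation of a partial derivative between [x] and a nearby point, which continuity at [x] makes
    small. *)
Lemma differentiable_C1 {R : realType} {n : nat} (F : 'rV[R]_n -> R) (x : 'rV[R]_n) :
  (\forall y \near x, forall i, derivable F y (delta_mx 0 i)) ->
  (forall i, {for x, continuous ('D_(delta_mx 0 i) F)}) ->
  differentiable F x.
Proof.
move=> dF cF.
have lin : linear (dot (grad F x) : 'rV[R]_n -> R).
  by move=> k u v; rewrite dotDr dotZr.
pose lM := GRing.isLinear.Build _ _ _ _ _ lin.
pose L : {linear 'rV[R]_n -> R} := HB.pack (dot (grad F x) : 'rV[R]_n -> R) lM.
have cL : continuous L by exact: dot_continuous.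
apply: (@differentiable_littleo _ _ _ F L x cL).
  apply/eqaddoP => _/posnumP[e].
  (* Each of the [n] terms gets a share of [e]; the divisor [n.+1] also covers [n = 0]. *)
  have e'0 : 0 < e%:num / n.+1%:R by rewrite divr_gt0.
  have cF' : \forall y \near x, forall i,
      `|'D_(delta_mx 0 i) F x - 'D_(delta_mx 0 i) F y| <= e%:num / n.+1%:R.
    have cFi i : \forall y \near nbhs x,
        `|'D_(delta_mx 0 i) F x - 'D_(delta_mx 0 i) F y| <= e%:num / n.+1%:R.
      by move/cvgrPdist_le : (cF i); exact.
    exact: filter_forall cFi.
  have : nbhs x [set y | (forall i, derivable F y (delta_mx 0 i)) /\
      (forall i, `|'D_(delta_mx 0 i) F x - 'D_(delta_mx 0 i) F y| <= e%:num / n.+1%:R)].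
    exact: filterI dF cF'.
  move=> /nbhs_ballP[r /= r0 ball_r].
  apply: filterS (nbhs0_lt r0) => h /= hr.
  have in_ball y : `|y - x| <= `|h| -> ball x r y.
    by move=> yh; rewrite -ball_normE /ball_/= distrC (le_lt_trans yh).
  have [y yh i|xi xih e1] := @increment_sum_partials _ _ F x h.
    by have [+ _] := ball_r y (in_ball y yh); exact.
  rewrite /= /cst !fctE /= opprD addrA (addrC h) e1 /dot.
  rewrite -sumrB (le_trans (ler_norm_sum _ _ _))//.
  apply: (@le_trans _ _ (\sum_(i < n) (e%:num / n.+1%:R * `|h|))).
    apply: ler_sum => i _; rewrite mxE (mulrC (h 0 i)) -mulrBl normrM.
    apply: ler_pM => //; last exact: coord_le_norm.
    by rewrite distrC; have [_] := ball_r _ (in_ball _ (xih i)); exact.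
  rewrite sumr_const card_ord -mulrnAl ler_wpM2r//.
  rewrite -mulr_natr mulrAC ler_pdivrMr// ler_wpM2l// ler_nat.
  exact: leqnSn.
Qed.

(** [phi] is only known to be derivable in the direction [v]. The chain rule for differentials is
    therefore applied to its restriction [l] to the line through [a], a function of one real
    variable, for which derivability and differentiability agree. *)
Lemma is_derive_comp_diff {R : realType} {U V W : normedModType R}
    (F : U -> W) (phi : V -> U) (a v : V) (dphi : U) :
  differentiable F (phi a) -> is_derive a v phi dphi ->
  is_derive a v (F \o phi) ('d F (phi a) dphi).
Proof.
move=> dF [dphia dphiE].
pose l (h : R) := phi (a + h *: v).
have l0 : l 0 = phi a by rewrite /l scale0r addr0.
have [dl dlE] : is_derive (0 : R) 1 l dphi.
  have := is_derive_line phi a v 0; rewrite scale0r addr0 dphiE => h; exact: h dphia.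
have dl' : differentiable l (0 : R) by move/derivable1_diffP : dl.
have dFl : differentiable F (l 0) by rewrite l0.
have dc := differentiable_comp dl' dFl.
have quotE : (fun h : R => h^-1 *: (((F \o phi) \o shift a) (h *: v) - (F \o phi) a))
    = (fun h : R => h^-1 *: (((F \o l) \o shift 0) (h *: 1) - (F \o l) 0)).
  apply/funext => h /=.
  by rewrite -[h%:A]/(h * 1) mulr1 addr0 l0 /l (addrC a).
split; first by rewrite /derivable quotE; move/derivable1_diffP : dc.
rewrite -l0 -dlE (deriveE _ dl') -[RHS]/(('d F (l 0) \o 'd l (0 : R)) 1).
by rewrite -(diff_comp dl' dFl) -(deriveE _ dc) /derive quotE.
Qed.

Lemma diff_dot_grad {R : realType} {n : nat} (F : 'rV[R]_n -> R) (x v : 'rV[R]_n) :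
  differentiable F x -> 'd F x v = dot (grad F x) v.
Proof.
move=> dF; rewrite {1}(row_sum_delta v) linear_sum; apply: eq_bigr => i _.
by rewrite linearZ mxE /= mulrC -deriveE.
Qed.

Lemma is_derive_comp_grad {R : realType} {n : nat} {V : normedModType R}
    (F : 'rV[R]_n -> R) (phi : V -> 'rV[R]_n) (a v : V) :
  differentiable F (phi a) -> derivable phi a v ->
  is_derive a v (F \o phi) (dot (grad F (phi a)) ('D_v phi a)).
Proof.
move=> dF dphi; rewrite -(diff_dot_grad _ _ _ dF).
exact: is_derive_comp_diff dF (derivableP dphi).
Qed.

(** * Functions of class C^k on open sets *)

Lemma near_on {T : topologicalType} (D : set T) (P : T -> Prop) (x : T) :
  open D -> D x -> (forall y, D y -> P y) -> \forall y \near x, P y.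
Proof. by move=> oD Dx DP; exact: filterS DP (open_nbhs_nbhs (conj oD Dx)). Qed.

Lemma near_eq_continuous {T U : topologicalType} (f g : T -> U) (x : T) :
  (\forall y \near x, f y = g y) -> {for x, continuous f} -> {for x, continuous g}.
Proof.
rewrite /prop_for /continuous_at => fg; rewrite -(nbhs_singleton fg).
by apply: cvg_trans; exact: near_eq_cvg.
Qed.

(** On an open set the derivatives depend only on the values there. This lets formulas for
    derivatives that hold only on [D] be substituted in the recursion defining [Ck_on]. *)
Lemma Ck_on_ext {R : realType} {n : nat} {W : normedModType R} (k : nat)
    (D : set 'rV[R]_n) (f g : 'rV[R]_n -> W) :
  open D -> (forall x, D x -> f x = g x) -> Ck_on k D f -> Ck_on k D g.
Proof.
move=> oD; elim: k f g => [|k IH] f g fg [cf df].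
all: have nfg x : D x -> \forall y \near x, f y = g y
  by move=> Dx; exact: near_on oD Dx fg.
all: have cg x : D x -> {for x, continuous g}
  by move=> Dx; exact: near_eq_continuous (nfg x Dx) (cf x Dx).
  by split.
split=> // i; have [dfi Cfi] := df i; split=> [x Dx|].
  by apply: near_eq_derivable (dfi x Dx); exact: nfg.
by apply: IH Cfi => x Dx; apply: near_eq_derive; exact: nfg.
Qed.

Lemma Ck_on_continuous {R : realType} {n : nat} {W : normedModType R} (k : nat)
    (D : set 'rV[R]_n) (f : 'rV[R]_n -> W) (x : 'rV[R]_n) :
  Ck_on k D f -> D x -> {for x, continuous f}.
Proof. by case: k => [|k] [cf _]; exact: cf. Qed.

Lemma Ck_onW {R : realType} {n : nat} {W : normedModType R} (k : nat)
    (D : set 'rV[R]_n) (f : 'rV[R]_n -> W) : Ck_on k.+1 D f -> Ck_on k D f.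
Proof.
elim: k f => [|k IH] f [cf df]; first by split.
split=> // i; have [dfi Cfi] := df i; split=> //; exact: IH.
Qed.

Lemma Ck_on_cst {R : realType} {n : nat} {W : normedModType R} (k : nat)
    (D : set 'rV[R]_n) (w : W) : Ck_on k D (cst w).
Proof.
elim: k w => [|k IH] w; first by split=> // x _; exact: cst_continuous.
split=> [x _|i]; first exact: cst_continuous.
split=> [x _|]; first exact: derivable_cst.
by rewrite (_ : 'D__ _ = cst 0); [exact: IH|apply/funext => x; exact: derive_cst].
Qed.

Lemma Ck_onD {R : realType} {n : nat} {W : normedModType R} (k : nat)
    (D : set 'rV[R]_n) (f g : 'rV[R]_n -> W) :
  open D -> Ck_on k D f -> Ck_on k D g -> Ck_on k D (fun x => f x + g x).
Proof.
move=> oD; elim: k f g => [|k IH] f g [cf df] [cg dg].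
all: have cfg x : D x -> {for x, continuous (fun x => f x + g x)}
  by move=> Dx; exact: continuousD (cf x Dx) (cg x Dx).
  by split.
split=> // i; have [dfi Cfi] := df i; have [dgi Cgi] := dg i; split=> [x Dx|].
  exact: derivableD (dfi x Dx) (dgi x Dx).
apply: Ck_on_ext oD _ (IH _ _ Cfi Cgi) => x Dx.
by rewrite -(deriveD (dfi x Dx) (dgi x Dx)).
Qed.

Lemma Ck_onM {R : realType} {n : nat} (k : nat)
    (D : set 'rV[R]_n) (f g : 'rV[R]_n -> R) :
  open D -> Ck_on k D f -> Ck_on k D g -> Ck_on k D (fun x => f x * g x).
Proof.
move=> oD; elim: k f g => [|k IH] f g Cf Cg; have [cf df] := Cf; have [cg dg] := Cg.
all: have cfg x : D x -> {for x, continuous (fun x => f x * g x)}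
  by move=> Dx; exact: continuousM (cf x Dx) (cg x Dx).
  by split.
split=> // i; have [dfi Cfi] := df i; have [dgi Cgi] := dg i; split=> [x Dx|].
  exact: derivableM (dfi x Dx) (dgi x Dx).
(* Each term of the product rule keeps one factor undifferentiated; [Ck_onW] lowers that factor to
   the order of the induction hypothesis. *)
have Cfdg := IH f _ (Ck_onW _ _ _ Cf) Cgi.
have Cgdf := IH g _ (Ck_onW _ _ _ Cg) Cfi.
apply: Ck_on_ext oD _ (Ck_onD _ _ _ _ oD Cfdg Cgdf) => x Dx.
exact: esym (deriveM (dfi x Dx) (dgi x Dx)).
Qed.

Lemma Ck_on_sum {R : realType} {n m : nat} {W : normedModType R} (k : nat)
    (D : set 'rV[R]_n) (f : 'I_m -> 'rV[R]_n -> W) :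
  open D -> (forall i, Ck_on k D (f i)) -> Ck_on k D (fun x => \sum_(i < m) f i x).
Proof.
move=> oD; elim: m f => [|m IH] f Cf.
  apply: Ck_on_ext oD _ (Ck_on_cst k D 0) => x _; by rewrite big_ord0.
apply: Ck_on_ext oD _ (Ck_onD _ _ _ _ oD (IH (fun i => f (widen_ord (leqnSn m) i)) _) (Cf ord_max)).
  by move=> x _; rewrite big_ord_recr.
by move=> i; exact: Cf.
Qed.

Lemma Ck_on_coord {R : realType} {n m : nat} (k : nat)
    (D : set 'rV[R]_n) (phi : 'rV[R]_n -> 'rV[R]_m) (j : 'I_m) :
  open D -> Ck_on k D phi -> Ck_on k D (fun x => phi x 0 j).
Proof.
move=> oD; elim: k phi => [|k IH] phi [cphi dphi].
all: have cj x : D x -> {for x, continuous (fun x => phi x 0 j)}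
  by move=> Dx; 
     exact: (continuous_comp (g := fun M : 'rV[R]_m => M 0 j) (cphi x Dx)
               (@coord_continuous _ _ _ _ _ _)).
  by split.
split=> // i; have [di Ci] := dphi i; split=> [x Dx|].
  by move/derivable_mxP : (di x Dx); exact.
by apply: Ck_on_ext oD _ (IH _ Ci) => x Dx; rewrite derive_mx ?mxE//; exact: di.
Qed.

Lemma Ck_on_id {R : realType} {n : nat} (k : nat) (D : set 'rV[R]_n) :
  open D -> Ck_on k D id.
Proof.
move=> oD; case: k => [|k]; first by split=> // x _; exact: cvg_id.
split=> [x _|i]; first exact: cvg_id.
split=> [x _|]; first exact: derivable_id.
by apply: Ck_on_ext oD _ (Ck_on_cst k D (delta_mx 0 i)) => x _; rewrite derive_id.
Qed.

Lemma Ck_on_differentiable {R : realType} {n : nat} (D : set 'rV[R]_n)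
    (F : 'rV[R]_n -> R) (k : nat) (x : 'rV[R]_n) :
  open D -> Ck_on k.+1 D F -> D x -> differentiable F x.
Proof.
move=> oD [_ dF] Dx; apply: differentiable_C1 => [|i].
  by apply: near_on oD Dx _ => y Dy i; have [+ _] := dF i; exact.
by have [_ /Ck_on_continuous] := dF i; exact.
Qed.

(** By the chain rule a partial derivative of the composite is a sum of products of
    [('D_(delta_mx 0 j) F) \o phi] with coordinates of a derivative of [phi]. The induction
    hypothesis is applied to the partial derivatives of [F], so it is general in [F] while [phi]
    stays fixed. *)
Lemma Ck_on_comp {R : realType} {n m : nat} (k : nat)
    (D : set 'rV[R]_n) (E : set 'rV[R]_m) (F : 'rV[R]_m -> R)
    (phi : 'rV[R]_n -> 'rV[R]_m) :
  open D -> open E -> set_fun D E phi -> Ck_on k E F -> Ck_on k D phi ->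
  Ck_on k D (F \o phi).
Proof.
move=> oD oE DE; elim: k F => [|k IH] F CF Cphi; have [cF dF] := CF; have [cphi dphi] := Cphi.
all: have cc x : D x -> {for x, continuous (F \o phi)}
  by move=> Dx; exact: continuous_comp (cphi x Dx) (cF _ (DE x Dx)).
  by split.
split=> // i; have [di Ci] := dphi i.
have chain x : D x -> is_derive x (delta_mx 0 i) (F \o phi)
    (dot (grad F (phi x)) ('D_(delta_mx 0 i) phi x)).
  move=> Dx; apply: is_derive_comp_grad (di x Dx).
  exact: Ck_on_differentiable oE CF (DE x Dx).
split=> [x Dx|]; first by case: (chain x Dx).
have Csum : Ck_on k D (fun x => \sum_(j < m)
    ((('D_(delta_mx 0 j) F) \o phi) x * 'D_(delta_mx 0 i) phi x 0 j)).
  apply: Ck_on_sum => // j; apply: Ck_onM => //; last exact: Ck_on_coord.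
  by apply: IH (Ck_onW _ _ _ Cphi); have [] := dF j.
apply: Ck_on_ext oD _ Csum => x Dx; have [_ ->] := chain x Dx.
by apply: eq_bigr => j _; rewrite mxE.
Qed.

Lemma Ck_onZ {R : realType} {n : nat} {W : normedModType R} (k : nat)
    (D : set 'rV[R]_n) (a : R) (f : 'rV[R]_n -> W) :
  open D -> Ck_on k D f -> Ck_on k D (fun x => a *: f x).
Proof.
move=> oD; elim: k f => [|k IH] f [cf df].
all: have cZ x : D x -> {for x, continuous (fun x => a *: f x)}
  by move=> Dx; exact: continuousZl_tmp (cf x Dx).
  by split.
split=> // i; have [di Ci] := df i; split=> [x Dx|].
  exact: derivableZ (di x Dx).
by apply: Ck_on_ext oD _ (IH _ Ci) => x Dx; exact: esym (deriveZ a (di x Dx)).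
Qed.

(** * Relations forced by two reflections *)

Lemma incoming_ray {R : realType} {n : nat} (gamma : R -> 'rV[R]_(n + 1))
    (x : 'rV[R]_n) (t1 : R) (v0 : 'rV[R]_(n + 1)) :
  (\forall t \near -oo, gamma t = pt x t) ->
  uniform_motion [set t | t <= t1] v0 gamma ->
  v0 = pt 0 1 /\ forall t, t <= t1 -> gamma t = pt x t.
Proof.
(* At [s] and [s - 1] the position is known and the first reflection has not yet occurred; these two
   positions determine the velocity, and uniform motion carries the formula up to [t1]. *)
move=> [M [_ far]] um; pose s := Num.min M t1 - 1.
have /andP[sM st1] : (s < M) && (s < t1) by rewrite -lt_min ltrBlDr ltrDl.
have s1s : s - 1 < s by rewrite ltrBlDr ltrDl.
have v0E : v0 = pt 0 1.
  have := um (s - 1) s (ltW (lt_trans s1s st1)) (ltW st1).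
  rewrite (far s sM) (far _ (lt_trans s1s sM)) (_ : s - (s - 1) = 1) ?scale1r; last by ring.
  move=> /(congr1 (fun w => w - pt x (s - 1))).
  rewrite (addrAC (pt x (s - 1))) subrr add0r => <-.
  rewrite -(scaleN1r (pt _ _)) ptZ ptD scaleN1r subrr mulN1r.
  by congr (pt 0 _); ring.
split=> // t tt1; rewrite (um s t (ltW st1) tt1) (far s sM) v0E ptZ ptD.
by rewrite scaler0 addr0; congr (pt x _); ring.
Qed.

Lemma outgoing_ray {R : realType} {n : nat} (gamma : R -> 'rV[R]_(n + 1))
    (y : 'rV[R]_n) (t2 tau : R) (v2 : 'rV[R]_(n + 1)) :
  (\forall t \near +oo, gamma t = pt y (t - tau)) ->
  uniform_motion [set t | t2 <= t] v2 gamma ->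
  v2 = pt 0 1 /\ forall t, t2 <= t -> gamma t = pt y (t - tau).
Proof.
move=> [M [_ far]] um; pose s := Num.max M t2 + 1.
have /andP[sM st2] : (M < s) && (t2 < s) by rewrite -gt_max ltrDl.
have s1s : s < s + 1 by rewrite ltrDl.
have v2E : v2 = pt 0 1.
  have := um s (s + 1) (ltW st2) (ltW (lt_trans st2 s1s)).
  rewrite (far s sM) (far _ (lt_trans sM s1s)) (addrC s) addrK scale1r.
  move=> /(congr1 (fun w => w - pt y (s - tau))).
  rewrite (addrAC (pt y (s - tau))) subrr add0r => <-.
  rewrite -(scaleN1r (pt _ _)) ptZ ptD scaleN1r subrr mulN1r.
  by congr (pt 0 _); ring.
split=> // t tt2; rewrite (um s t (ltW st2) tt2) (far s sM) v2E ptZ ptD.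
by rewrite scaler0 addr0; congr (pt y _); ring.
Qed.

Lemma dot_graph_normal {R : realType} {n : nat} (p : 'rV[R]_n) :
  dot (pt p (-1)) (pt p (-1)) = 1 + dot p p.
Proof. by rewrite dot_pt mulrNN mulr1 addrC. Qed.

Lemma graph_normal_gt0 {R : realType} {n : nat} (p : 'rV[R]_n) : 0 < 1 + dot p p.
Proof. by rewrite ltr_wpDr// dot_ge0. Qed.

Lemma reflect_vertical {R : realType} {n : nat} (p : 'rV[R]_n) :
  let k := 2 / (1 + dot p p) in
  reflect_along (pt p (-1)) (pt 0 1) = pt (k *: p) (1 - k).
Proof.
rewrite /= /reflect_along dot_graph_normal dot_pt.
have -> : dot 0 p = 0 by rewrite /dot big1// => i _; rewrite mxE mul0r.
rewrite -scaleNr ptZ ptD !add0r; congr pt.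
  by congr (_ *: _); field; rewrite gt_eqF// graph_normal_gt0.
by field; rewrite gt_eqF// graph_normal_gt0.
Qed.

(* [tau] is the delay of the particle with respect to the vertical motion. *)
Lemma two_mirror_relations {R : realType} {n : nat} (x y p q : 'rV[R]_n) (a b L : R)
    (v1 : 'rV[R]_(n + 1)) :
  0 < L -> v1 = reflect_along (pt p (-1)) (pt 0 1) ->
  pt 0 1 = reflect_along (pt q (-1)) v1 -> pt y b = pt x a + L *: v1 ->
  exists tau, [/\ 0 < tau, y - x = tau *: p, q = p, 0 < tau + (b - a) &
    (tau + (b - a)) ^+ 2 = dot (y - x) (y - x) + (b - a) ^+ 2].
Proof.
move=> L0 v1E v2E yE; have P0 := graph_normal_gt0 p.
rewrite reflect_vertical in v1E; set k := 2 / _ in v1E.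
have k0 : 0 < k by rewrite divr_gt0.
rewrite v1E ptZ ptD in yE; have [yxE baE] := pt_inj _ _ _ _ yE.
have yx : y - x = (L * k) *: p by rewrite yxE addrAC subrr add0r scalerA.
have baL : L * k + (b - a) = L by rewrite baE; ring.
(* In time [L] the particle rises by [L * (1 - k)], so unit speed vertical motion gains [L * k] on
   it. *)
exists (L * k); split=> //; [exact: mulr_gt0| |by rewrite baL|rewrite baL].
  move: v2E; rewrite /reflect_along v1E; set s := (X in X *: pt q _).
  rewrite -(scaleNr s) ptZ ptD => /pt_inj[pE kE].
  (* The last coordinate determines the coefficient [s] of the second reflection; the horizontal
     coordinates then give [q = p]. *)
  have sk : s = k by move: kE; rewrite mulrNN mulr1 => kE; lra.
  apply: (scalerI (lt0r_neq0 k0)); move: pE; rewrite sk scaleNr => pE.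
  by apply/eqP; rewrite eq_sym -subr_eq0 -pE.
(* The middle segment is run through at unit speed: the identity amounts to
   [k * (1 + dot p p) = 2]. *)
rewrite yx dotZl dotZr (_ : b - a = L * (1 - k)); last by rewrite baE; ring.
rewrite /k; field.
by rewrite gt_eqF.
Qed.

Lemma realized_relations {R : realType} {n : nat} (D1 D2 : set 'rV[R]_n)
    (f : 'rV[R]_n -> 'rV[R]_n) (Phi1 Phi2 : 'rV[R]_n -> R) (x : 'rV[R]_n) :
  realized_by D1 D2 f Phi1 Phi2 -> D1 x ->
  let H := Phi2 (f x) - Phi1 x in
  exists tau, [/\ 0 < tau, f x - x = tau *: grad Phi1 x,
    grad Phi2 (f x) = grad Phi1 x, 0 < tau + H &
    (tau + H) ^+ 2 = dot (f x - x) (f x - x) + H ^+ 2].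
Proof.
move=> [_ [_ real]] Dx; have [gamma [near_in refl [tau near_out]]] := real x Dx.
move: refl => [t1 [t2 [v0 [v1 [v2 [[lt12 g1 g2 _] [[u0 u1 u2] [_ v1E v2E]]]]]]]].
have [v0z _] := incoming_ray _ _ _ _ near_in u0.
have [v2z _] := outgoing_ray _ _ _ _ _ near_out u2.
apply: (@two_mirror_relations _ _ x (f x) _ _ _ _ (t2 - t1) v1).
- by rewrite subr_gt0.
- by rewrite v1E v0z.
- by rewrite -v2z v2E.
- by rewrite -g1 -g2; apply: u1 => /=; rewrite lexx ltW.
Qed.

(** * Constancy of the delay *)

Lemma constant_of_partials0 {R : realType} {n : nat} (D : set 'rV[R]_n)
    (T : 'rV[R]_n -> R) :
  open D -> connected D ->
  (forall x i, D x -> is_derive x (delta_mx 0 i) T 0) ->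
  forall x y, D x -> D y -> T x = T y.
Proof.
move=> oD cD dT x y Dx Dy.
(* [T] is constant on every ball contained in [D], because all partial derivatives in the increment
   formula vanish. *)
have loc z : D z -> \forall w \near z, D w /\ T w = T z.
  move=> Dz; have /nbhs_ballP[r /= r0 zrD] : nbhs z D by exact: open_nbhs_nbhs.
  apply/nbhs_ballP; exists r => //= w zw; split; first exact: zrD.
  have near_z u : `|u - z| <= `|w - z| -> D u.
    move=> uz; apply: zrD; move: zw; rewrite -ball_normE /ball_/= distrC => zw.
    by rewrite distrC (le_lt_trans uz).
  have [u /near_z Du i|xi xiz] := @increment_sum_partials _ _ T z (w - z).
    by have [] := dT u i Du.
  rewrite (addrC z) subrK => /eqP; rewrite big1 ?subr_eq0 => [/eqP//|i _].
  by have [_ ->] := dT _ i (near_z _ (xiz i)); rewrite mulr0.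
suff : D `&` [set w | T w = T x] = D by move=> /seteqP[_ /(_ y Dy)[_ ->]].
apply: cD; first by exists x.
- exists (D `&` [set w | T w = T x]); last by rewrite setIA setIid.
  rewrite openE => z [Dz Tz]; rewrite /interior /=.
  by apply: filterS (loc z Dz) => w [Dw Tw]; split; rewrite //= Tw.
(* The part of [D] where [T] differs from [T x] is open, again by [loc]; its complement is closed
   and cuts out of [D] exactly the level set. *)
- exists (~` (D `&` [set w | T w <> T x])); last first.
    apply/seteqP; split=> z [Dz Tz]; split=> //; first by move=> [].
    by apply: contrapT => Tz'; exact: Tz.
  apply: open_closedC; rewrite openE => z [Dz Tz]; rewrite /interior /=.
  by apply: filterS (loc z Dz) => w [Dw Tw]; split; rewrite //= Tw.
Qed.

Lemma is_derive_dot_self {R : realType} {n : nat} {V : normedModType R}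
    (phi : V -> 'rV[R]_n) (a v : V) (dphi : 'rV[R]_n) :
  is_derive a v phi dphi ->
  is_derive a v (fun x => dot (phi x) (phi x)) (2 * dot (phi a) dphi).
Proof.
move=> [dphia dphiE].
have dcoord (i : 'I_n) : is_derive a v (fun x => phi x 0 i : R) (dphi 0 i).
  split; first by move/derivable_mxP : dphia; exact.
  by rewrite -dphiE derive_mx// mxE.
have dsum := @is_derive_sum R V _ n
  (fun i => (fun x => phi x 0 i : R) * (fun x => phi x 0 i : R)) a v
  (fun i => phi a 0 i *: dphi 0 i + phi a 0 i *: dphi 0 i)
  (fun i => is_deriveM (dcoord i) (dcoord i)).
have -> : 2 * dot (phi a) dphi = \sum_(i < n) (phi a 0 i *: dphi 0 i + phi a 0 i *: dphi 0 i).
  by rewrite /dot mulr_sumr; apply: eq_bigr => i _; rewrite mulr_natl mulr2n.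
have -> : (fun x => dot (phi x) (phi x)) =
    \sum_(i < n) ((fun x => phi x 0 i : R) * (fun x => phi x 0 i : R)).
  by apply/funext => x; rewrite fct_sumE.
exact: dsum.
Qed.

Lemma realized_delay_constant {R : realType} {n : nat} (D1 D2 : set 'rV[R]_n)
    (f : 'rV[R]_n -> 'rV[R]_n) (Phi1 Phi2 : 'rV[R]_n -> R) :
  open D1 -> open D2 -> connected D1 -> D1 !=set0 -> set_fun D1 D2 f -> smooth_on D1 f ->
  realized_by D1 D2 f Phi1 Phi2 ->
  exists2 c, 0 < c & forall x, D1 x -> f x - x = c *: grad Phi1 x.
Proof.
move=> o1 o2 c1 [x0 Dx0] fD fs real; have [sm1 [sm2 _]] := real.
pose H x := Phi2 (f x) - Phi1 x.
(* The relations give the delay only point by point, as an existential. Taking the positive root of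
   the length identity gives a formula for it that can be differentiated. *)
pose T x := Num.sqrt (dot (f x - x) (f x - x) + H x ^+ 2) - H x.
have TE x tau : 0 < tau + H x ->
    (tau + H x) ^+ 2 = dot (f x - x) (f x - x) + H x ^+ 2 -> T x = tau.
  by move=> pos sq; rewrite /T -sq sqrtr_sqr gtr0_norm// addrK.
have TP x : D1 x -> 0 < T x /\ f x - x = T x *: grad Phi1 x.
  move=> Dx; have [tau [tau0 fxE _ pos sq]] := realized_relations _ _ _ _ _ _ real Dx.
  by rewrite (TE x tau pos sq).
suff Tcst x : D1 x -> T x = T x0.
  exists (T x0) => [|x Dx]; first by have [] := TP x0 Dx0.
  by rewrite -(Tcst x Dx); have [_] := TP x Dx.
move=> Dx; apply: (constant_of_partials0 D1) => // {Dx}x i Dx.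
have [tau [tau0 fxE qE pos sq]] := realized_relations _ _ _ _ _ _ real Dx.
have [_ /(_ i)[/(_ x Dx) df _]] := fs 1%N.
pose e : 'rV[R]_n := delta_mx 0 i; pose p := grad Phi1 x.
have dP1 : is_derive x e Phi1 (dot p e).
  have dPhi1 := Ck_on_differentiable _ _ _ _ o1 (sm1 1%N) Dx.
  have := @is_derive_comp_grad R n _ Phi1 id x e dPhi1 (@derivable_id R _ x e).
  by rewrite derive_id => h; exact: h.
have dP2 : is_derive x e (Phi2 \o f) (dot p ('D_e f x)).
  rewrite /p -qE.
  exact: is_derive_comp_grad (Ck_on_differentiable _ _ _ _ o2 (sm2 1%N) (fD x Dx)) df.
(* Since the two gradients coincide, one vector [p] governs the variation of both mirror heights. *)
have dH : is_derive x e H (dot p ('D_e f x - e)).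
  by rewrite dotDr -scaleN1r dotZr mulN1r; exact: is_deriveB dP2 dP1.
pose N z := dot (f z - z) (f z - z) + H z ^+ 2.
have Nx : N x = (tau + H x) ^+ 2 by rewrite /N -sq.
(* Because [f x - x = tau *: p], the derivative of [N] is [2 * (tau + H x)] times that of [H]. As
   [tau + H x] is the square root of [N x], the derivatives of [Num.sqrt (N z)] and [H z] cancel in
   [T]. *)
have dN : is_derive x e N (2 * ((tau + H x) * dot p ('D_e f x - e))).
  have -> : 2 * ((tau + H x) * dot p ('D_e f x - e)) =
      2 * dot (f x - x) ('D_e f x - e) +
      (H x *: dot p ('D_e f x - e) + H x *: dot p ('D_e f x - e)).
    by rewrite fxE dotZl -/p /GRing.scale /=; ring.
  have dfid := is_deriveB (derivableP df) (@is_derive_id R _ x e).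
  have := is_deriveD (is_derive_dot_self _ _ _ _ dfid) (is_deriveM dH dH).
  by move=> h; exact: h.
have N0 : 0 < N x by rewrite Nx exprn_gt0.
have [dsqrt dsqrtE] := is_derive1_sqrt N0.
have diff_sqrt : differentiable (@Num.sqrt R) (N x) by move/derivable1_diffP : dsqrt.
have := is_deriveB (is_derive_comp_diff _ _ _ _ _ diff_sqrt dN) dH.
rewrite (deriv1E dsqrt) derive1E dsqrtE Nx sqrtr_sqr gtr0_norm//.
have -> : 2 * ((tau + H x) * dot p ('D_e f x - e)) *: (2 * (tau + H x))^-1 -
   dot p ('D_e f x - e) = 0.
  by rewrite /GRing.scale /=; field; rewrite gt_eqF.
by move=> h; exact: h.
Qed.

(** * Segments in convex domains and bounds on increments *)

Lemma convex_set_segment {R : realType} {M : lmodType R} (D : set M) (x y : M) (s : R) :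
  convex_set (D : set (convex_lmodType M)) -> D x -> D y -> 0 <= s <= 1 ->
  D (x + s *: (y - x)).
Proof.
move=> cD Dx Dy /andP[s0 s1]; have := cD y x (Itv01 s0 s1).
rewrite !inE => /(_ Dy Dx).
rewrite (_ : x + s *: (y - x) = s *: y + (1 - s) *: x); first by move=> h; exact: h.
by rewrite scalerBl scale1r scalerBr addrCA.
Qed.

Lemma bounded_set_norm {R : realType} {V : normedModType R} (D : set V) :
  bounded_set D -> exists2 M : R, 0 < M & forall x, D x -> `|x| <= M.
Proof. by move=> /pinfty_ex_gt0[M M0 DM]; exists M. Qed.

(** A crude form of the Cauchy-Schwarz inequality; the factor [n] appears because [|u|] is the
    maximum norm. *)
Lemma norm_dot_le {R : realType} {n : nat} (u v : 'rV[R]_n) :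
  `|dot u v| <= n%:R * (`|u| * `|v|).
Proof.
rewrite (le_trans (ler_norm_sum _ _ _))//.
have -> : n%:R * (`|u| * `|v|) = \sum_(i < n) `|u| * `|v|.
  by rewrite sumr_const card_ord mulr_natl.
apply: ler_sum => i _.
by rewrite normrM ler_pM// coord_le_norm.
Qed.

Lemma convex_increment_le {R : realType} {n : nat} (D : set 'rV[R]_n)
    (F : 'rV[R]_n -> R) (x y : 'rV[R]_n) (K : R) :
  open D -> convex_set (D : set (convex_lmodType 'rV[R]_n)) -> Ck_on 1 D F ->
  D x -> D y -> (forall z, D z -> `|dot (grad F z) (y - x)| <= K) ->
  `|F y - F x| <= K.
Proof.
move=> oD cD CF Dx Dy gradK.
have Dseg (s : R) : (0 <= s <= 1) || (1 <= s <= 0) -> D (x + s *: (y - x)).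
  case/orP => [|/andP[s1 /(le_trans s1)]]; first exact: convex_set_segment.
  by rewrite ler10.
have dF z : D z -> differentiable F z by exact: Ck_on_differentiable oD CF.
have [s /Dseg Ds|s /Dseg Ds] := @MVT_line _ _ F x (y - x) 1.
  exact/diff_derivable/dF.
rewrite scale1r (addrC x) subrK mul1r => ->.
by rewrite (deriveE _ (dF _ Ds)) diff_dot_grad ?gradK//; exact: dF.
Qed.

(** * Building the trajectory and the second mirror *)

Lemma reflect_alongK {R : realType} {n : nat} (nu v : 'rV[R]_n) :
  dot nu nu != 0 -> reflect_along nu (reflect_along nu v) = v.
Proof.
move=> nu0; rewrite /reflect_along; set k := 2 * dot v nu / dot nu nu.
have -> : 2 * dot (v - k *: nu) nu / dot nu nu = - k.
  by rewrite -scaleNr dotDl dotZl /k; field.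
by rewrite scaleNr opprK subrK.
Qed.

(** The hypothesis on [b - a] is the length identity [(c + (b - a)) ^+ 2 = dot (y - x) (y - x) + (b
    - a) ^+ 2] after expansion. With [y - x = c *: p] it gives [L = c * (1 + dot p p) / 2], which
    matches the coefficient of [reflect_vertical]. *)
Lemma unit_speed_broken_line {R : realType} {n : nat} (x y p : 'rV[R]_n) (a b c : R) :
  0 < c -> y - x = c *: p -> 2 * c * (b - a) = dot (y - x) (y - x) - c ^+ 2 ->
  let L := c + (b - a) in
  let v1 := reflect_along (pt p (-1)) (pt 0 1) in
  0 < L /\ L *: v1 = pt (y - x) (b - a).
Proof.
move=> c0 yx H L v1; have P0 := graph_normal_gt0 p.
have LE : L = c * (1 + dot p p) / 2.
  by move: H; rewrite yx dotZl dotZr /L => H; nra.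
split; first by rewrite LE divr_gt0// mulr_gt0.
rewrite /v1 reflect_vertical ptZ scalerA yx; congr pt.
  by congr (_ *: _); rewrite LE; field; rewrite gt_eqF.
rewrite [RHS](_ : _ = L - c); last by rewrite /L; ring.
by rewrite LE; field; rewrite gt_eqF.
Qed.

Lemma broken_line_trajectory {R : realType} {n : nat} (M : set 'rV[R]_(n + 1))
    (x y p : 'rV[R]_n) (a b c : R) :
  0 < c -> y - x = c *: p -> 2 * c * (b - a) = dot (y - x) (y - x) - c ^+ 2 ->
  (forall t, M (pt x t) <-> t = a) -> (forall t, M (pt y t) <-> t = b) ->
  (forall s, 0 < s < 1 -> ~ M (pt (x + s *: (y - x)) (a + s * (b - a)))) ->
  exists gamma : R -> 'rV[R]_(n + 1),
    [/\ \forall t \near -oo, gamma t = pt x t,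
        two_reflections M (pt x a) (pt p (-1)) (pt y b) (pt p (-1)) gamma &
        exists tau : R, \forall t \near +oo, gamma t = pt y (t - tau)].
Proof.
move=> c0 yx H Mx My Mseg.
have [] := unit_speed_broken_line _ _ _ _ _ _ c0 yx H.
set L := c + _; set v1 := reflect_along _ _ => L0 Lv1.
(* Height equals time until the first reflection, at time [a]; the second occurs at time [a + L],
   when the height is [b = a + L - c], and from then on the height lags behind time by [c]. *)
pose gamma t := if t <= a then pt x t else
  if t <= a + L then pt x a + (t - a) *: v1 else pt y (t - c).
have aL : a < a + L by rewrite ltrDl.
have gamma0 t : t <= a -> gamma t = pt x t by rewrite /gamma => ->.
have gamma1 t : a <= t <= a + L -> gamma t = pt x a + (t - a) *: v1.
  rewrite /gamma => /andP[at1 ->]; case: leP => // ta.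
  by have -> : t = a; [apply/eqP; rewrite eq_le ta|rewrite subrr scale0r addr0].
have gamma_seg s : 0 <= s <= 1 ->
    gamma (a + s * L) = pt (x + s *: (y - x)) (a + s * (b - a)).
  move=> /andP[s0 s1]; rewrite gamma1.
    by rewrite addrAC subrr add0r -scalerA Lv1 ptZ ptD.
  by rewrite lerDl lerD2l mulr_ge0 ?(ltW L0)//= ler_piMl// ltW.
have gammaL : gamma (a + L) = pt y b.
  rewrite -{1}(mul1r L) gamma_seg ?ler01 ?lexx// scale1r mul1r.
  by congr pt; [rewrite addrC subrK|ring].
have gamma2 t : a + L <= t -> gamma t = pt y (t - c).
  rewrite le_eqVlt => /orP[/eqP <-|tL].
    by rewrite gammaL /L; congr (pt y _); ring.
  by rewrite /gamma !leNgt tL (lt_trans aL tL).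
exists gamma; split.
- by exists a; split=> [|t /ltW ta]; [exact: num_real|exact: gamma0].
- exists a, (a + L), (pt 0 1), v1, (pt 0 1); split; [split=> //|split; split].
  + exact: gamma0.
  + move=> t; split=> [|[->|->]]; last 2 first.
    * by rewrite gamma0//; apply/Mx.
    * by rewrite gammaL; apply/My.
    have [ta|at1] := leP t a; first by rewrite gamma0// => /Mx; left.
    have [tL|Lt] := ltP t (a + L).
      have L' := lt0r_neq0 L0.
      (* [(t - a) / L] is the fraction of the middle segment covered at time [t]. *)
      rewrite (_ : t = a + (t - a) / L * L); last by field.
      have s01 : 0 < (t - a) / L < 1.
        by rewrite divr_gt0 ?subr_gt0//= ltr_pdivrMr// mul1r ltrBlDl.
      rewrite gamma_seg ?(ltW (andP s01).1) ?(ltW (andP s01).2)//.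
      by move/Mseg : s01.
    by rewrite gamma2// => /My tb; right; rewrite /L -tb; ring.
  + move=> s t /= sa ta; rewrite !gamma0// ptZ ptD scaler0 addr0.
    by congr (pt x _); ring.
  + move=> s t /= sa ta; rewrite !gamma1// -addrA -scalerDl.
    by congr (_ + _ *: _); ring.
  + move=> s t /= sa ta; rewrite !gamma2// ptZ ptD scaler0 addr0.
    by congr (pt y _); ring.
  + by rewrite dot_pt /dot big1 ?add0r ?mulr1// => i _; rewrite mxE mul0r.
  + by [].
  (* Both mirrors have the same normal here, so the second reflection undoes the first. *)
  + by rewrite reflect_alongK// dot_graph_normal gt_eqF// graph_normal_gt0.
- exists c, (a + L); split=> [|t /ltW tL]; [exact: num_real|exact: gamma2].
Qed.

(** The height over [y] at which a ray that comes from the first mirror over [f' y] has delay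
    exactly [c]: the length identity solved for the height difference. *)
Definition second_mirror {R : realType} {n : nat} (f' : 'rV[R]_n -> 'rV[R]_n)
    (Phi1 : 'rV[R]_n -> R) (c : R) (y : 'rV[R]_n) : R :=
  Phi1 (f' y) + (2 * c)^-1 * (dot (y - f' y) (y - f' y) - c ^+ 2).

Lemma smooth_on_second_mirror {R : realType} {n : nat} (D1 D2 : set 'rV[R]_n)
    (f' : 'rV[R]_n -> 'rV[R]_n) (Phi1 : 'rV[R]_n -> R) (c : R) :
  open D1 -> open D2 -> set_fun D2 D1 f' -> smooth_on D2 f' -> smooth_on D1 Phi1 ->
  smooth_on D2 (second_mirror f' Phi1 c).
Proof.
move=> o1 o2 f'D sf' sPhi1 k.
have Cd : Ck_on k D2 (fun y => y - f' y).
  apply: (Ck_on_ext _ _ (fun y => y + -1 *: f' y)) => // [y _|].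
    by rewrite scaleN1r.
  apply: Ck_onD => //; first exact: Ck_on_id.
  exact: Ck_onZ.
apply: Ck_onD => //; first exact: (Ck_on_comp k D2 D1 Phi1 f' o2 o1 f'D (sPhi1 k) (sf' k)).
apply: Ck_onM => //; first exact: Ck_on_cst.
apply: Ck_onD => //; last exact: Ck_on_cst.
by apply: Ck_on_sum => // i; apply: Ck_onM => //; exact: Ck_on_coord.
Qed.

(** The derivative of [f'] enters through [Phi1 \o f'] and through the squared distance; by the
    formula for [grad Phi1] these two contributions cancel, leaving only the derivative of [y]
    itself. *)
Lemma grad_second_mirror {R : realType} {n : nat} (D1 D2 : set 'rV[R]_n)
    (f' : 'rV[R]_n -> 'rV[R]_n) (Phi1 : 'rV[R]_n -> R) (c : R) (y : 'rV[R]_n) :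
  open D1 -> set_fun D2 D1 f' -> smooth_on D2 f' -> smooth_on D1 Phi1 ->
  0 < c -> D2 y -> grad Phi1 (f' y) = c^-1 *: (y - f' y) ->
  grad (second_mirror f' Phi1 c) y = c^-1 *: (y - f' y).
Proof.
move=> o1 f'D sf' sPhi1 c0 Dy gradE; apply/rowP => i; rewrite [LHS]mxE.
pose e : 'rV[R]_n := delta_mx 0 i.
have [_ /(_ i)[/(_ y Dy) df' _]] := sf' 1%N.
have dPhi1 : differentiable Phi1 (f' y).
  exact: Ck_on_differentiable o1 (sPhi1 1%N) (f'D y Dy).
have d1 := is_derive_comp_grad Phi1 f' y e dPhi1 df'.
have d2 := is_derive_dot_self _ _ _ _
  (is_deriveB (@is_derive_id R _ y e) (derivableP df')).
have d3 := is_deriveD d1 (is_deriveZ (2 * c)^-1 (is_deriveB d2 (is_derive_cst (c ^+ 2) y e))).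
have -> : 'D_(delta_mx 0 i) (second_mirror f' Phi1 c) y =
    dot (grad Phi1 (f' y)) ('D_e f' y) +
    (2 * c)^-1 *: (2 * dot (y - f' y) (e - 'D_e f' y) - 0).
  by case: d3.
rewrite gradE dotDr -(scaleN1r ('D_e f' y)) dotZr dotZl.
have -> : dot (y - f' y) e = (y - f' y) 0 i.
  rewrite /dot (bigD1 i)//= big1 => [|j ji]; rewrite [e 0 _]mxE eqxx /=.
    by rewrite eqxx mulr1 addr0.
  by rewrite (negPf ji) mulr0.
by rewrite /GRing.scale /= [RHS]mxE; field; rewrite gt_eqF.
Qed.

Lemma realized_by_second_mirror {R : realType} {n : nat} (D1 D2 : set 'rV[R]_n)
    (f f' : 'rV[R]_n -> 'rV[R]_n) (Phi1 : 'rV[R]_n -> R) (c K : R) :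
  open D1 -> open D2 ->
  convex_set (D1 : set (convex_lmodType 'rV[R]_n)) ->
  convex_set (D2 : set (convex_lmodType 'rV[R]_n)) -> D1 `&` D2 = set0 ->
  set_fun D1 D2 f -> set_fun D2 D1 f' -> smooth_on D2 f' ->
  {in D1, cancel f f'} -> {in D2, cancel f' f} ->
  smooth_on D1 Phi1 -> (forall x, D1 x -> grad Phi1 x = c^-1 *: (f x - x)) ->
  (forall z x, D1 z -> D1 x -> `|dot (f z - z) (f x - x)| <= K) ->
  0 < c -> 3 * K < c ^+ 2 ->
  realized_by D1 D2 f Phi1 (second_mirror f' Phi1 c).
Proof.
move=> o1 o2 cv1 cv2 disj fD f'D sf' fK f'K sPhi1 gPhi1 gK c0 Kc.
set Phi2 := second_mirror _ _ _.
have sPhi2 : smooth_on D2 Phi2 by exact: smooth_on_second_mirror o1 o2 f'D sf' sPhi1.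
have gPhi2 y : D2 y -> grad Phi2 y = c^-1 *: (y - f' y).
  move=> Dy; apply: (grad_second_mirror D1 D2) => //.
  by rewrite gPhi1 ?f'K ?inE//; exact: f'D.
have not12 z : D1 z -> D2 z -> False.
  by move=> D1z D2z; have : (D1 `&` D2) z by []; rewrite disj.
split=> //; split=> // x Dx; have Dy := fD x Dx.
set y := f x in Dy *; set a := Phi1 x; set b := Phi2 y.
have xE : f' y = x by rewrite fK ?inE.
have Kg : dot (y - x) (y - x) <= K.
  by rewrite (le_trans (ler_norm _)) ?gK.
have K0 : 0 <= K by rewrite (le_trans _ Kg) ?dot_ge0.
have baE : 2 * c * (b - a) = dot (y - x) (y - x) - c ^+ 2.
  by rewrite /b /Phi2 /second_mirror xE -/a; field; rewrite gt_eqF.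
have ic0 : 0 < c^-1 by rewrite invr_gt0.
(* By [baE], [- (c * (b - a))] is half of [c ^+ 2 - dot (y - x) (y - x)], which exceeds half of
   [3 * K - K]; this is the origin of the factor 3. *)
have ba : K < - (c * (b - a)) by nra.
(* The middle segment drops by more than [c^-1 * K] per unit of its parameter, too steeply for a
   mirror whose height varies by at most that much. *)
have far (s F : R) : 0 < s -> `|F| <= s * (c^-1 * K) -> F != s * (b - a).
  move=> s0; apply: contraTneq => ->; rewrite -ltNge normrM gtr0_norm// ltr_pM2l//.
  by rewrite ltr_pdivrMl// ltr0_norm ?mulrN//; nra.
have gPhi2y : grad Phi2 y = grad Phi1 x by rewrite gPhi2// xE gPhi1.
rewrite /graph_normal gPhi2y; apply: (broken_line_trajectory _ _ _ _ _ _ c) => //.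
- by rewrite gPhi1// scalerA divff ?scale1r// gt_eqF.
(* A vertical line over a point of one domain misses the other mirror, since the domains are
   disjoint. *)
- move=> t; split=> [[|] [z Dz /pt_inj[zx <-]]|->]; last by left; exists x.
    by rewrite zx.
  by case: (not12 x); rewrite // -zx.
- move=> t; split=> [[|] [z Dz /pt_inj[zy <-]]|->]; last by right; exists y.
    by case: (not12 y); rewrite // -zy.
  by rewrite zy.
- move=> s /andP[s0 s1] [|] [z Dz /pt_inj[zE Phi_z]].
    have zx : z - x = s *: (y - x) by rewrite zE addrAC subrr add0r.
    have /eqP[] : Phi1 z - Phi1 x != s * (b - a).
      apply: far => //; apply: (convex_increment_le D1) => // w Dw.
      rewrite zx gPhi1// dotZl dotZr mulrCA 2!normrM (gtr0_norm s0) (gtr0_norm ic0).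
      by rewrite ler_pM2l// ler_pM2l// gK.
    by rewrite Phi_z addrAC subrr add0r.
  have zy : z - y = - (1 - s) *: (y - x).
    rewrite zE; apply/rowP => i; rewrite !mxE; ring.
  have s1' : 0 < 1 - s by rewrite subr_gt0.
  (* For the second mirror the steepness argument starts from the endpoint [y], with parameter
     [1 - s]. *)
  have /eqP[] : - (Phi2 z - Phi2 y) != (1 - s) * (b - a).
    apply: far => //; rewrite normrN.
    apply: (convex_increment_le D2) => // w Dw.
    rewrite zy gPhi2// dotZl dotZr mulrCA 2!normrM normrN (gtr0_norm s1') (gtr0_norm ic0).
    rewrite ler_pM2l// ler_pM2l//.
    (* Since [w = f (f' w)], the vector [w - f' w] is the displacement of a point of [D1], to which
       [gK] applies. *)
    by have := gK (f' w) x; rewrite f'K ?inE//; apply => //; exact: f'D.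
  by rewrite Phi_z -/b; ring.
Qed.

(** * Assembling the two directions *)

Lemma gradZ {R : realType} {n : nat} (k : R) (F : 'rV[R]_n -> R) (x : 'rV[R]_n) :
  (forall i, derivable F x (delta_mx 0 i)) ->
  grad (fun z => k * F z) x = k *: grad F x.
Proof. by move=> dF; apply/rowP => i; rewrite !mxE; exact: deriveZ. Qed.

Lemma realized_gradient {R : realType} {n : nat} (D1 D2 : set 'rV[R]_n)
    (f : 'rV[R]_n -> 'rV[R]_n) (Phi1 Phi2 : 'rV[R]_n -> R) :
  open D1 -> open D2 -> connected D1 -> D1 !=set0 -> set_fun D1 D2 f -> smooth_on D1 f ->
  realized_by D1 D2 f Phi1 Phi2 ->
  exists2 c : R, 0 < c & smooth_on D1 (fun x => c * Phi1 x) /\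
    forall x, D1 x -> f x - x = grad (fun z => c * Phi1 z) x.
Proof.
move=> o1 o2 c1 ne1 fD sf real; have [sPhi1 _] := real.
have [c c0 cE] := realized_delay_constant _ _ _ _ _ o1 o2 c1 ne1 fD sf real.
exists c => //; split=> [k|x Dx]; first by apply: Ck_onM => //; exact: Ck_on_cst.
have [_ dPhi1] := sPhi1 1%N.
by rewrite gradZ ?cE// => i; have [+ _] := dPhi1 i; exact.
Qed.

Theorem theorem1 (R : realType) (n : nat) (D1 D2 : set 'rV[R]_n)
    (f g : 'rV[R]_n -> 'rV[R]_n)
    (dom1 : bounded_domain D1) (dom2 : bounded_domain D2)
    (diffeo_f : diffeomorphism D1 D2 f)
    (g_def : forall x, D1 x -> g x = f x - x) :
  (forall Phi1 Phi2 : 'rV[R]_n -> R, realized_by D1 D2 f Phi1 Phi2 ->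
     exists G : 'rV[R]_n -> R,
       [/\ smooth_on D1 G,
           forall x, D1 x -> g x = grad G x &
           exists2 c : R, 0 < c & forall x, D1 x -> G x = c * Phi1 x])
  /\
  (convex_set D1 -> convex_set D2 -> D1 `&` D2 = set0 ->
   forall G : 'rV[R]_n -> R,
     smooth_on D1 G -> (forall x, D1 x -> g x = grad G x) ->
     infinite_set [set (graph D1 Phi.1, graph D2 Phi.2) |
                   Phi in [set Phi : ('rV[R]_n -> R) * ('rV[R]_n -> R) |
                           realized_by D1 D2 f Phi.1 Phi.2]] /\
     exists2 c0 : R, 0 < c0 &
       forall c h : R, c0 < c ->
         exists Phi2 : 'rV[R]_n -> R,
           realized_by D1 D2 f (fun x => c^-1 * G x + h) Phi2).
Proof.
have [D1o c1 ne1 b1] := dom1; have [D2o c2 ne2 b2] := dom2.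
have [fD [sf [f' [f'D sf' fK f'K]]]] := diffeo_f.
split=> [Phi1 Phi2 real|cv1 cv2 disj G sG gG].
  have [c c0 [sG gG]] := realized_gradient _ _ _ _ _ D1o D2o c1 ne1 fD sf real.
  exists (fun x => c * Phi1 x); split=> [//|x Dx|]; last by exists c.
  by rewrite g_def// gG.
have [M1 M10 M1P] := bounded_set_norm _ b1.
have [M2 M20 M2P] := bounded_set_norm _ b2.
pose K := n%:R * ((M2 + M1) * (M2 + M1)).
have gbound x : D1 x -> `|f x - x| <= M2 + M1.
  move=> Dx; rewrite (le_trans (ler_normB _ _))// lerD ?M1P// M2P//; exact: fD.
have gK z x : D1 z -> D1 x -> `|dot (f z - z) (f x - x)| <= K.
  move=> Dz Dx; rewrite (le_trans (norm_dot_le _ _))// ler_wpM2l//.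
  by rewrite ler_pM// gbound.
have K0 : 0 <= K by rewrite mulr_ge0// mulr_ge0// addr_ge0// ltW.
pose Phi1 (c h : R) x := c^-1 * G x + h.
(* The added 1 gives [1 < c], hence [3 * K < c < c ^+ 2]. *)
have real c h : 3 * K + 1 < c -> realized_by D1 D2 f (Phi1 c h) (second_mirror f' (Phi1 c h) c).
  move=> Kc; have c0 : 0 < c by lra.
  have [_ dG] := sG 1%N.
  apply: (realized_by_second_mirror _ _ _ _ _ _ K) => //.
  - move=> k; apply: Ck_onD => //; last exact: Ck_on_cst.
    by apply: Ck_onM => //; exact: Ck_on_cst.
  - move=> x Dx; rewrite -g_def// gG//; apply/rowP => i; rewrite !mxE.
    have [/(_ x Dx) dGi _] := dG i.
    have [_] := is_deriveD (is_deriveZ c^-1 (derivableP dGi)) (is_derive_cst h x (delta_mx 0 i)).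
    by rewrite addr0.
  - nra.
split; last first.
  exists (3 * K + 1); first by rewrite ltr_wpDl// mulr_ge0.
  by move=> c h cK; exists (second_mirror f' (Phi1 c h) c); exact: real.
pose c := 3 * K + 2; have cK : 3 * K + 1 < c by rewrite ltrD2l ltr1n.
(* With [c] fixed, natural heights [h] already give infinitely many systems: comparing the first
   mirrors over one point of [D1] shows that [mirrors] is injective. *)
pose mirrors (m : nat) := (graph D1 (Phi1 c m%:R), graph D2 (second_mirror f' (Phi1 c m%:R) c)).
move=> fin; apply: infinite_nat.
rewrite (_ : [set: nat] = mirrors @^-1` [set (graph D1 Phi.1, graph D2 Phi.2) | Phi in
    [set Phi | realized_by D1 D2 f Phi.1 Phi.2]]); last first.
  apply/esym/seteqP; split=> // m _ /=.
  by exists (Phi1 c m%:R, second_mirror f' (Phi1 c m%:R) c) => //; exact: real.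
apply: finite_preimage fin => m1 m2 _ _ [eq_graph _].
have [x0 Dx0] := ne1.
have : graph D1 (Phi1 c m1%:R) (pt x0 (Phi1 c m1%:R x0)) by exists x0.
rewrite eq_graph => -[z _ /pt_inj[->]] /addrI /eqP.
by rewrite eqr_nat => /eqP.
Qed.
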